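(* Let $k\in \mathbb{Z}$ and $n,j\in\mathbb{Z}^+$, and let $G=(V,E)$ be a $j$-regular simple graph. If $(j, n) \mid k$, then $\chi_{(n,k)}(G) = \chi(G)$. If $G$ is finite and $(j, n) \nmid k|V|$, then $\chi_{(n,k)}(G)$ does not exist.
   Context: $(a,b)$ denotes the greatest common divisor. A $\mathbb{Z}$-labeling of $G$ is a map $\ell:V\to\mathbb{Z}$; its order is the size of its range; it is proper if adjacent vertices get different labels; $\chi(G)$ is the minimum order of a proper labeling. $N(v)$ is the open neighborhood of $v$. An open coloring with remainder $k \bmod n$ is a labeling with $\sum_{w\in N(v)}\ell(w)\equiv k \pmod n$ for all $v\in V$. If no proper such coloring exists, $\chi_{(n,k)}(G)$ does not exist; if proper such colorings of finite order exist, $\chi_{(n,k)}(G)$ is the minimum order of one; if they exist only of infinite order, $\chi_{(n,k)}(G)=\infty$. *)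

(* Defs.v *)
From mathcomp Require Import all_boot all_order all_algebra finmap.
From mathcomp Require Import boolp classical_sets functions cardinality fsbigop.

Set Implicit Arguments.
Unset Strict Implicit.
Unset Printing Implicit Defensive.

Import Order.TTheory GRing.Theory Num.Theory.
Local Open Scope card_scope.
Local Open Scope classical_set_scope.
Local Open Scope ring_scope.

(* Vertex sets are arbitrary, possibly infinite. Requiring a [choiceType] is
   no restriction classically; it is what sums over sets of vertices need. *)
Record simple_graph (V : choiceType) := SimpleGraph {
  adj : V -> V -> Prop;
  adj_sym : forall u v, adj u v -> adj v u;
  adj_irrefl : forall v, ~ adj v v
}.

Definition nbhd (V : choiceType) (G : simple_graph V) (v : V) : set V :=
  [set w | adj G v w].

Definition regular (V : choiceType) (G : simple_graph V) (j : nat) : Prop :=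
  forall v, nbhd G v #= `I_j.

Definition proper (V : choiceType) (G : simple_graph V) (l : V -> int) : Prop :=
  forall u v, adj G u v -> l u <> l v.

(* The sum is the intended one when neighborhoods are finite, as they are in a
   regular graph; it defaults to 0 when its support is infinite. *)
Definition open_coloring (V : choiceType) (G : simple_graph V) (n : nat)
    (k : int) (l : V -> int) : Prop :=
  forall v, (\sum_(w \in nbhd G v) l w = k %[mod n%:Z])%Z.

Inductive chromatic_value : Type :=
  | DoesNotExist
  | Finite of nat
  | Infinite.

Definition has_order (V : choiceType) (l : V -> int) (m : nat) : Prop :=
  range l #= `I_m.

Definition min_order (V : choiceType) (P : set (V -> int)) : chromatic_value :=
  match pselect (exists m, `[< exists2 l, P l & has_order l m >]) with
  | left ex => Finite (ex_minn ex)
  | right _ => if `[< exists l, P l >] then Infinite else DoesNotExist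
  end.

Definition chi (V : choiceType) (G : simple_graph V) : chromatic_value :=
  min_order [set l | proper G l].

Definition chi_mod (V : choiceType) (G : simple_graph V) (n : nat) (k : int) :
    chromatic_value :=
  min_order [set l | proper G l /\ open_coloring G n k l].

(* Main.v *)
(* If j a = k (mod n), then composing any proper labeling with the injection
   x |-> a + n x gives a proper open coloring of the same order. Conversely, summing
   the congruences of an open coloring over all the vertices counts each label j
   times, so that k |V| is congruent modulo n to a multiple of j. *)

Require Import Defs.
From mathcomp Require Import all_boot all_order all_algebra finmap.
From mathcomp Require Import boolp classical_sets functions cardinality fsbigop.
From mathcomp Require Import ring.

Set Implicit Arguments.
Unset Strict Implicit.
Unset Printing Implicit Defensive.

Import Order.TTheory GRing.Theory Num.Theory.
Local Open Scope card_scope.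
Local Open Scope classical_set_scope.
Local Open Scope ring_scope.

(** The value depends only on which finite orders are attained and on whether any labeling exists;
    the hypotheses make both agree for [P] and [Q]. *)
Lemma min_order_eq (V : choiceType) (P Q : set (V -> int)) :
  (forall l, P l -> Q l) ->
  (forall l, Q l -> exists2 l', P l' & range l' #= range l) ->
  min_order P = min_order Q.
Proof.
move=> PQ QP; rewrite /min_order.
have eqPQ m : `[< exists2 l, P l & has_order l m >] =
              `[< exists2 l, Q l & has_order l m >].
  apply: asbool_equiv_eq; split.
    by case=> l Pl lm; exists l => //; exact: PQ.
  case=> l /QP[l' Pl' l'l] lm; exists l' => //.
  exact: card_eq_trans l'l lm.
have -> : `[< exists l, P l >] = `[< exists l, Q l >].
  apply: asbool_equiv_eq; split; first by case=> l /PQ; exists l.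
  by case=> l /QP[l' Pl' _]; exists l'.
case: pselect => [exP|noP]; case: pselect => [exQ|noQ] //.
- by congr Defs.Finite; exact: eq_ex_minn.
- by case: noQ; case: exP => m; rewrite eqPQ; exists m.
- by case: noP; case: exQ => m; rewrite -eqPQ; exists m.
Qed.

Lemma min_order_set0 (V : choiceType) (P : set (V -> int)) :
  (forall l, ~ P l) -> min_order P = DoesNotExist.
Proof.
move=> P0; rewrite /min_order; case: pselect => [ex|_].
  by exfalso; case: ex => m /asboolP[l /P0].
by rewrite asboolF // => -[l /P0].
Qed.

Lemma linear_congruence_solvable (a n k : int) :
  (gcdz a n %| k)%Z -> exists x, (a * x = k %[mod n])%Z.
Proof.
have [u [v <-]] := Bezoutz a n; case/dvdzP => q ->; exists (q * u).
(* With [k = q (u a + v n)], the difference [a (q u) - k] is [- (q v) n]. *)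
apply/eqP; rewrite eqz_mod_dvd; apply/dvdzP; exists (- (q * v)).
ring.
Qed.

Section RegularGraph.
Variables (V : choiceType) (G : simple_graph V) (j : nat).
Hypothesis regG : regular G j.

Lemma nbhd_finite (v : V) : finite_set (nbhd G v).
Proof. by apply/finite_setP; exists j; exact: regG. Qed.

Lemma sum_nbhd_const (v : V) (c : int) : \sum_(w \in nbhd G v) c = j%:Z * c.
Proof.
rewrite (fsbig_finite _ _ (nbhd_finite v)) big_const_seq count_predT.
by rewrite (card_fset_set (regG v)) iter_addr_0 -mulr_natl natz.
Qed.

(** The [j] neighbors contribute [j a] through the constant term; the rest is a multiple of [n]. *)
Lemma open_coloring_affine (n : nat) (k a : int) (l : V -> int) :
  (j%:Z * a = k %[mod n%:Z])%Z ->
  open_coloring G n k (fun v => a + n%:Z * l v).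
Proof.
move=> jak v; rewrite fsbig_split /= ?sum_nbhd_const; last exact: nbhd_finite.
by rewrite -mulr_fsumr -jak addrC mulrC modzMDl.
Qed.

(** Double counting: [l w] occurs once for each [v] adjacent to [w], hence [j] times. *)
Lemma sum_sum_nbhd (l : V -> int) : finite_set [set: V] ->
  \sum_(v \in [set: V]) \sum_(w \in nbhd G v) l w =
  j%:Z * \sum_(v \in [set: V]) l v.
Proof.
move=> finV; rewrite mulr_fsumr.
(* Extending by zero makes the inner range independent of [v], so that the sums can be exchanged. *)
have nbhdE v (F : V -> int) : \sum_(w \in nbhd G v) F w =
    \sum_(w <- fset_set [set: V]) if w \in nbhd G v then F w else 0.
  by rewrite fsbig_mkcond (fsbig_finite _ _ finV).
rewrite !(fsbig_finite _ _ finV) (eq_bigr _ (fun v _ => nbhdE v l)).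
rewrite exchange_big; apply: eq_bigr => w _ /=.
rewrite -(sum_nbhd_const w) nbhdE; apply: eq_bigr => v _.
suff -> : (w \in nbhd G v) = (v \in nbhd G w) by [].
by apply/idP/idP; rewrite !inE => /adj_sym.
Qed.

Lemma open_coloring_gcd_dvd (n : nat) (k : int) (l : V -> int) :
  finite_set [set: V] -> open_coloring G n k l ->
  (gcdz j%:Z n%:Z %| k * (#|` fset_set [set: V]|)%:Z)%Z.
Proof.
move=> finV lk.
have n_dvd : (n%:Z %| j%:Z * \sum_(v \in [set: V]) l v
                      - k * (#|` fset_set [set: V]|)%:Z)%Z.
  rewrite -sum_sum_nbhd // fsbig_finite //.
  (* As a constant sum, [k |V|] can be subtracted vertex by vertex, each difference being divisible
     by [n]. *)
  have -> : k * (#|` fset_set [set: V]|)%:Z = \sum_(v <- fset_set [set: V]) k.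
    by rewrite big_const_seq count_predT iter_addr_0 -mulr_natr natz.
  rewrite -sumrB; apply: rpred_sum => v _.
  by rewrite -[_ \in _]eqz_mod_dvd; apply/eqP/lk.
(* The gcd divides both [n] and the multiple of [j], hence also [k |V|]. *)
rewrite -(rpredBl (x := j%:Z * \sum_(v \in [set: V]) l v)).
  exact: dvdz_trans (dvdz_gcdr _ _) n_dvd.
by apply: dvdz_mulr; exact: dvdz_gcdl.
Qed.

End RegularGraph.

Theorem theorem5p5 (k : int) (n j : nat) (hn : (0 < n)%N) (hj : (0 < j)%N)
    (V : choiceType) (G : simple_graph V) (hG : regular G j) :
  ((gcdz j%:Z n%:Z %| k)%Z -> chi_mod G n k = chi G) /\
  (finite_set [set: V] ->
   ~~ (gcdz j%:Z n%:Z %| k * (#|` fset_set [set: V]|)%:Z)%Z ->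
   chi_mod G n k = DoesNotExist).
Proof.
split=> [/linear_congruence_solvable[a jak]|finV ndvd].
  apply: min_order_eq => [l []//|l properl].
  have n0 : n%:Z != 0 by rewrite -lt0n.
  have inj_aff : injective (fun x : int => a + n%:Z * x).
    by move=> x y /addrI /(mulfI n0).
  exists (fun v => a + n%:Z * l v).
    split; last exact: open_coloring_affine.
    by move=> u v /properl luv /inj_aff.
  (* The new range is the image of the old one under an injection, so the orders agree even when
     infinite. *)
  have <- : (fun x : int => a + n%:Z * x) @` range l =
            range (fun v => a + n%:Z * l v) by rewrite image_comp.
  by apply: inj_card_eq => x y _ _; exact: inj_aff.
apply: min_order_set0 => l [_ lk].
by move: ndvd; rewrite (open_coloring_gcd_dvd hG finV lk).
Qed.
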